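(* Let $X$ be a sober topological space with a countable open set lattice $\mathcal{O}(X)$ (ordered by inclusion). Let $\geq$ denote the dual of the specialization order on $X$. Consider the following statements: \begin{enumerate} \item $\mathcal{O}(X)$ is a continuous domain; \item $\mathcal{O}(X)$ is an algebraic domain; \item $(X,\geq)$ is a quasicontinuous poset; \item $(X,\geq)$ is a quasialgebraic poset. \end{enumerate} Then (1) is equivalent to (2), and either of (1) or (2) implies (3) and (4). If $(X,\geq)$ is a dcpo, then all four statements are equivalent.
   Context: A space $X$ is sober if every irreducible closed subset is the closure of a unique singleton. The specialization order on a $T_0$ space $X$ is: $x\leq y$ iff $x$ belongs to the closure of $\{y\}$. A dcpo is a poset in which every directed subset has a supremum. In a poset $P$, $\mathord{\uparrow}x=\{y\in P\mid x\leq y\}$ and $\mathord{\uparrow}A=\bigcup_{x\in A}\mathord{\uparrow}x$. We write $x\ll y$ if for every directed $D\subseteq P$ whose supremum exists, $y\leq\sup D$ implies $x\leq d$ for some $d\in D$. $P$ is continuous if for each $y\in P$ the set $\{x\in P\mid x\ll y\}$ is directed with supremum $y$; $P$ is algebraic if for each $y\in P$ the set $\{x\in P\mid x\ll x\leq y\}$ is directed with supremum $y$. Continuous (algebraic) dcpos are called continuous (algebraic) domains. For subsets $F,G\subseteq P$, $F\ll G$ means: for every directed $D\subseteq P$ whose supremum exists, $\sup D\in\mathord{\uparrow}G$ implies $d\in\mathord{\uparrow}F$ for some $d\in D$; $F\ll x$ means $F\ll\{x\}$. The Smyth preorder is $F\sqsubseteq G$ iff $G\subseteq\mathord{\uparrow}F$.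 $P$ is quasicontinuous if for each $x\in P$ the set $\mathrm{fin}(x)=\{F\subseteq P\mid F\text{ finite},\ F\ll x\}$ is directed in the Smyth preorder and $\mathord{\uparrow}x=\bigcap_{F\in\mathrm{fin}(x)}\mathord{\uparrow}F$. If in addition, for each $x\in P$, the set $\mathrm{fin}_c(x)=\{F\subseteq P\mid F\text{ finite},\ F\ll F\ll x\}$ is directed in the Smyth preorder and $\mathord{\uparrow}x=\bigcap_{F\in\mathrm{fin}_c(x)}\mathord{\uparrow}F$, then $P$ is quasialgebraic. In statements (3) and (4) these notions are applied to the poset $(X,\geq)$. *)

(* Defs.v *)
From HB Require Import structures.
From mathcomp Require Import all_boot all_order.
From mathcomp Require Import all_classical topology separation_axioms.

Set Implicit Arguments.
Unset Strict Implicit.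
Unset Printing Implicit Defensive.

Import Order.TTheory.

Local Open Scope classical_set_scope.

Definition directed (T : Type) (R : T -> T -> Prop) (A : set T) : Prop :=
  A !=set0 /\ forall x y, A x -> A y -> exists2 z, A z & R x z /\ R y z.

Section Posets.
Context {d : Order.disp_t} (P : porderType d).
Implicit Types (x y : P) (F G D : set P).
Local Open Scope order_scope.

Definition directed_subset D : Prop := directed (fun x y => x <= y) D.

Definition dcpo : Prop :=
  forall D, directed_subset D -> exists s, isLub D s.

Definition up_set F : set P := [set y | exists2 x, F x & x <= y].

Definition way_below x y : Prop :=
  forall D s, directed_subset D -> isLub D s -> y <= s ->
    exists2 e, D e & x <= e.

Definition continuous_poset : Prop := forall y,
  directed_subset [set x | way_below x y] /\ isLub [set x | way_below x y] y.

Definition algebraic_poset : Prop := forall y,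
  directed_subset [set x | way_below x x /\ x <= y] /\
  isLub [set x | way_below x x /\ x <= y] y.

Definition continuous_domain : Prop := dcpo /\ continuous_poset.

Definition algebraic_domain : Prop := dcpo /\ algebraic_poset.

Definition way_below_set F G : Prop :=
  forall D s, directed_subset D -> isLub D s -> up_set G s ->
    exists2 e, D e & up_set F e.

Definition smyth F G : Prop := G `<=` up_set F.

Definition fin x : set (set P) :=
  [set F | finite_set F /\ way_below_set F [set x]].

Definition finc x : set (set P) :=
  [set F | [/\ finite_set F, way_below_set F F & way_below_set F [set x]]].

Definition quasicontinuous_poset : Prop := forall x,
  directed smyth (fin x) /\ up_set [set x] = \bigcap_(F in fin x) up_set F.

Definition quasialgebraic_poset : Prop :=
  quasicontinuous_poset /\ forall x,
    directed smyth (finc x) /\ up_set [set x] = \bigcap_(F in finc x) up_set F.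

End Posets.

Arguments way_below {d P} x y.
Arguments way_below_set {d P} F G.
Arguments smyth {d P} F G.
Arguments fin {d P} x.
Arguments finc {d P} x.

Section Sober.
Variable X : topologicalType.
Implicit Types (x y : X) (C : set X).

Definition irreducible_set C : Prop :=
  C !=set0 /\ forall A B : set X,
    closed A -> closed B -> C `<=` A `|` B -> C `<=` A \/ C `<=` B.

Definition sober : Prop := forall C,
  closed C -> irreducible_set C -> exists! x, C = closure [set x].

Lemma closure1_sub x y :
  closure [set y] x -> closure [set x] `<=` closure [set y].
Proof.
move=> yx; have /closure_id -> := @closed_closure _ [set y].
by apply: closureS => _ ->.
Qed.

Lemma closure1_mem x : closure [set x] x.
Proof. exact: subset_closure. Qed.

Lemma irreducible_closure1 x : irreducible_set (closure [set x]).
Proof.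
split; first by exists x; exact: closure1_mem.
move=> A B cA cB AB; have [Ax|Bx] := AB _ (@closure1_mem x); [left|right].
- by rewrite [B in _ `<=` B](closure_id A).1 //; apply: closureS => _ ->.
- by rewrite [A in _ `<=` A](closure_id B).1 //; apply: closureS => _ ->.
Qed.

Lemma closure1_anti x y : kolmogorov_space X ->
  closure [set y] x -> closure [set x] y -> x = y.
Proof.
move=> T0 yx xy; apply: contrapT => /eqP /T0 [A [|]] [] /set_mem An /set_mem Ac.
- by have [_ [->]] := yx _ An.
- by have [_ [->]] := xy _ An.
Qed.

Lemma sober_kolmogorov : sober -> kolmogorov_space X.
Proof.
move=> sX x y xy; apply: contrapT => nsep.
have xcly : closure [set y] x.
  move=> A Ax; exists y; split => //; apply: contrapT => nAy.
  by apply: nsep; exists A; left; split; exact/mem_set.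
have yclx : closure [set x] y.
  move=> A Ay; exists x; split => //; apply: contrapT => nAx.
  by apply: nsep; exists A; right; split; exact/mem_set.
have [z [_ uz]] := sX _ (@closed_closure _ _) (irreducible_closure1 x).
move/eqP: xy; apply; rewrite -(uz x erefl); apply: uz.
by rewrite eqEsubset; split; exact: closure1_sub.
Qed.

End Sober.
Arguments sober X : clear implicits.

Record opens (X : topologicalType) :=
  Opens { opens_val :> set X; _ : opens_val \in @open X }.

HB.instance Definition _ X := [isSub for @opens_val X].
HB.instance Definition _ X := [Choice of opens X by <:].
HB.instance Definition _ X :=
  [SubChoice_isSubPOrder of opens X by <: with set_display].

Lemma opens_leP (X : topologicalType) (U V : opens X) :
  (U <= V)%O <-> U `<=` V.
Proof. by split=> /asboolP. Qed.

(* The proof argument lets the instance below be found: the specialization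
   preorder is antisymmetric only on a T0 space. *)
Definition spec (X : topologicalType) (T0 : kolmogorov_space X) : Type := X.

Fact spec_display : Order.disp_t. Proof. by []. Qed.

Section Spec.
Variables (X : topologicalType) (T0 : kolmogorov_space X).

Let le (x y : spec T0) : bool := `[< closure [set (y : X)] (x : X) >].

Let le_refl : reflexive le.
Proof. by move=> x; apply/asboolP; exact: closure1_mem. Qed.

Let le_anti : antisymmetric le.
Proof.
by move=> x y /andP[/asboolP yx /asboolP xy]; exact: closure1_anti T0 yx xy.
Qed.

Let le_trans : transitive le.
Proof.
move=> y x z /asboolP yx /asboolP zy; apply/asboolP.
exact: closure1_sub zy _ yx.
Qed.

HB.instance Definition _ := Choice.copy (spec T0) X.
HB.instance Definition _ :=
  Order.Le_isPOrder.Build spec_display (spec T0) le_refl le_anti le_trans.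

Lemma spec_leP (x y : spec T0) :
  (x <= y)%O <-> closure [set (y : X)] (x : X).
Proof. by split=> /asboolP. Qed.

Lemma dual_spec_leP (x y : (spec T0)^d) :
  (x <= y)%O <-> closure [set (x : X)] (y : X).
Proof. exact: spec_leP. Qed.

End Spec.

(* Main.v *)
Require Import Defs.
From mathcomp Require Import all_boot all_order.
From mathcomp Require Import all_classical topology.
Set Implicit Arguments.
Unset Strict Implicit.
Unset Printing Implicit Defensive.
Import Order.TTheory.
Local Open Scope classical_set_scope.

(** Two consequences of countability drive the proof.

    In a countable continuous dcpo, whenever x is way below y there is a compact
    element between them ([compact_between]): otherwise interpolation yields
    nested intervals [a_n, b_n], with a_n way below b_n, the n-th of which avoids
    the n-th element of an enumeration, while the supremum of the a_n lies in all
    of them.  Hence continuity and algebraicity agree for the lattice of opens.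

    In a sober space with countably many opens, every closed set is a finite
    union of point closures ([closed_finite_union]).  Each point of a closed set
    C lies below a maximal point of C, so it suffices that C has only finitely
    many maximal points.  An infinite set M of maximal points is never
    irreducible, since the generic point of its closure would be above all of
    M; so M splits, and one piece is infinite again.  Iterating produces points
    x_n of which none is in the closure of the others, and then the closures of
    the sets of x_n are uncountably many closed sets.

    Write P for X ordered by the dual of specialization.  The upper closure in P
    of a finite set is a finite union of point closures, so complementation
    matches the opens of X with the finitely generated upper sets of P, and
    directed unions of opens with filtered intersections of these.
    - If D is directed in P with supremum s, the upper closures of the points of
      D intersect in that of s.  Therefore the way-below relation between opens
      implies the one between the generating finite sets
      ([way_below_set_of_opens]), and continuity (algebraicity) of the lattice
      of opens passes to quasicontinuity (quasialgebraicity) of P.  Smyth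
      directedness is automatic, because the intersection of two finitely
      generated upper sets is closed, hence again finitely generated.
    - If P is a dcpo, the converse implication holds ([way_below_set_opens]).
      This is Rudin's lemma, which here reduces to a sequential argument of
      Koenig type because a family of opens can be enumerated; it turns
      quasicontinuity of P into continuity of the lattice of opens. *)

(** * Choice, enumeration and finite bounds *)

Lemma countable_enum (T : Type) (x0 : T) : countable [set: T] ->
  exists e : nat -> T, forall x, exists n, e n = x.
Proof.
move=> /pfcard_geP[T0|[e]]; first by have : [set: T] x0 by []; rewrite T0.
exists e => x; have [n _ <-] := @surj _ _ _ _ e x I.
by exists n.
Qed.

(** The relation depends on the stage so that a diagonal construction can deal at
    stage n with the n-th term of an enumeration. *)
Lemma dependent_choice_inv (T : Type) (P : T -> Prop)
    (R : nat -> T -> T -> Prop) :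
  (exists x, P x) ->
  (forall n x, P x -> exists2 y, P y & R n x y) ->
  exists u : nat -> T, forall n, P (u n) /\ R n (u n) (u n.+1).
Proof.
move=> [x0 Px0] step.
have /choice[f fP] : forall a : nat * {x | P x}, exists y : {x | P x},
    R a.1 (sval a.2) (sval y).
  by move=> [n [x Px]]; have [y Py Rxy] := step n x Px; exists (exist _ y Py).
pose u := fix u n := if n is m.+1 then f (m, u m) else exist P x0 Px0.
by exists (fun n => sval (u n)) => n; split; [exact: svalP|exact: (fP (n, u n))].
Qed.

Lemma directed_finite (T : Type) (I : eqType) (R : T -> T -> Prop) (D : set T)
    (F : set I) (Q : I -> T -> Prop) :
  (forall i x y, R x y -> Q i x -> Q i y) ->
  directed R D -> finite_set F ->
  (forall i, F i -> exists2 x, D x & Q i x) ->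
  exists2 x, D x & forall i, F i -> Q i x.
Proof.
move=> RQ [[x0 Dx0] dirD] /finite_seqP[s ->].
elim: s => [|i s IHs] FQ; first by exists x0.
have [x Dx Qix] : exists2 x, D x & Q i x by apply: FQ; rewrite /= mem_head.
have [j js|y Dy Qsy] := IHs; first by apply: FQ; rewrite /= inE js orbT.
have [z Dz [Rxz Ryz]] := dirD x y Dx Dy.
exists z => // j; rewrite /= inE => /orP[/eqP ->|js]; first exact: RQ Qix.
by apply: RQ Ryz _; exact: Qsy.
Qed.

(** * Countable continuous posets *)

Section CountableContinuous.
Context {d : Order.disp_t} (P : porderType d).
Implicit Types x y z : P.
Local Open Scope order_scope.

Lemma directed_subset1 x : directed_subset [set x].
Proof. by split=> [|a b -> ->]; exists x. Qed.

Lemma isLub1 x : isLub [set x] x.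
Proof. by split=> [a ->|b]; [exact: lexx|exact]. Qed.

Lemma way_below_le x y : way_below x y -> x <= y.
Proof.
by move=> /(_ _ _ (directed_subset1 y) (isLub1 y) (lexx y))[_ ->].
Qed.

Lemma le_way_below_le x x' y y' :
  x <= x' -> way_below x' y' -> y' <= y -> way_below x y.
Proof.
move=> xx' x'y' y'y D s dD Ds ys.
have [e De x'e] := x'y' D s dD Ds (le_trans y'y ys).
by exists e; rewrite ?(le_trans xx').
Qed.

(** The elements that are twice way below z form a directed set with the same
    supremum z. *)
Lemma way_below_interpolation x z : continuous_poset P -> way_below x z ->
  exists2 y, way_below x y & way_below y z.
Proof.
move=> cP xz; pose D := [set w | exists2 y, way_below w y & way_below y z].
have [[[a az] dirz] [zub zlub]] := cP z.
have dD : directed_subset D.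
  split=> [|w1 w2 [y1 wy1 yz1] [y2 wy2 yz2]].
    by have [[[b ba] _] _] := cP a; exists b, a.
  have [y yz [y1y y2y]] := dirz _ _ yz1 yz2.
  have [[_ diry] _] := cP y.
  have [||w wy [w1w w2w]] := diry w1 w2.
  - exact: le_way_below_le wy1 y1y.
  - exact: le_way_below_le wy2 y2y.
  by exists w => //; exists y.
have Dz : isLub D z.
  split=> [w [y /way_below_le wy /way_below_le yz]|b Db].
    exact: le_trans wy yz.
  apply: zlub => y yz; have [_ [_]] := cP y; apply=> w wy.
  by apply: Db; exists y.
have [w [y wy yz] xw] := xz D z dD Dz (lexx z).
by exists y => //; exact: le_way_below_le xw wy (lexx y).
Qed.

(** Diagonal argument: without a compact element between x and y, interpolation
    splits an interval [a, b] with a way below b into two disjoint ones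
    [a, a'] and [b', b] of the same kind, and one of them avoids the n-th
    element of the poset.  The supremum of the lower ends of the resulting
    nested intervals belongs to all of them, so it is not in the
    enumeration. *)
Lemma compact_between x y : countable [set: P] -> continuous_domain P ->
  way_below x y -> exists k, [/\ way_below k k, x <= k & k <= y].
Proof.
move=> cP [dP contP] xy; apply: contrapT => nocompact.
have [e eP] := countable_enum x cP.
pose inv (p : P * P) := [/\ way_below p.1 p.2, x <= p.1 & p.2 <= y].
pose R n (p q : P * P) :=
  [/\ p.1 <= q.1, q.2 <= p.2 & ~ (q.1 <= e n <= q.2)].
have [|n [a b] [/= ab xa yb]|u uP] := @dependent_choice_inv _ inv R.
- by exists (x, y); split=> /=.
- have [b' ab' bb'] := way_below_interpolation contP ab.
  have [a' aa' ab''] := way_below_interpolation contP ab'.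
  have aa'le := way_below_le aa'; have b'b := way_below_le bb'.
  have a'b' := way_below_le ab''.
  have [a'e|a'e] := boolP (e n <= a').
    exists (b', b); first by split=> //=; rewrite (le_trans xa)// (le_trans aa'le).
    split=> //=; first by rewrite (le_trans aa'le).
    case/andP=> b'e _; apply: nocompact; exists a'.
    (* The n-th element is in both intervals, so a' = b', and a' << b' makes it
       compact. *)
    have eab : a' = b' by apply/le_anti; rewrite a'b' (le_trans b'e).
    split; first by rewrite {2}eab.
      exact: le_trans xa aa'le.
    by rewrite eab (le_trans b'b).
  exists (a, a'); first by split=> //=; rewrite (le_trans a'b') ?(le_trans b'b).
  split=> //=; first exact: le_trans a'b' b'b.
  by case/andP=> _; exact/negP.
have u1 : {homo (fun n => (u n).1) : m n / (m <= n)%N >-> m <= n}.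
  apply: homo_leq => [//|? ? ?|i]; first exact: le_trans.
  by have [_ []] := uP i.
have u2 : {homo (fun n => (u n).2) : m n / (m <= n)%N >-> n <= m}.
  apply: homo_leq => [//|a b c ba cb|i]; first exact: le_trans cb ba.
  by have [_ []] := uP i.
have dU : directed_subset (range (fun n => (u n).1)).
  split=> [|_ _ [m _ <-] [n _ <-]]; first by exists (u 0%N).1, 0%N.
  exists (u (maxn m n)).1; first by exists (maxn m n).
  by rewrite !u1 ?leq_maxl ?leq_maxr.
have [s [sub slub]] := dP _ dU.
have [n en] := eP s.
have [_ [_ _]] := uP n; apply; apply/andP; rewrite en; split.
  by apply: sub; exists n.+1.
apply: slub => _ [m _ <-].
have [[/way_below_le le_m _ _] _] := uP (maxn m n.+1).
apply: le_trans (u1 _ _ (leq_maxl m n.+1)) _.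
by apply: le_trans le_m _; apply: u2; exact: leq_maxr.
Qed.

Lemma algebraic_continuous : algebraic_poset P -> continuous_poset P.
Proof.
move=> aP y; have [[[k0 [kk0 k0y]] diry] [yub ylub]] := aP y.
have below k : way_below k k -> k <= y -> way_below k y.
  by move=> kk ky; exact: le_way_below_le kk ky.
split; last first.
  split=> [x /way_below_le //|b xb]; apply: ylub => k [kk ky].
  by apply: xb; exact: below.
split=> [|a b ay bY]; first by exists k0; exact: below.
have [ka [kka kay] aka] := ay _ _ (proj1 (aP y)) (proj2 (aP y)) (lexx y).
have [kb [kkb kby] bkb] := bY _ _ (proj1 (aP y)) (proj2 (aP y)) (lexx y).
have [k [kk ky] [kak kbk]] := diry ka kb (conj kka kay) (conj kkb kby).
by exists k; [exact: below|rewrite (le_trans aka) ?(le_trans bkb)].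
Qed.

Lemma countable_continuous_algebraic :
  countable [set: P] -> continuous_domain P -> algebraic_poset P.
Proof.
move=> cP cdP y; have [[[x0 x0y] diry] [yub ylub]] := cdP.2 y.
have between := compact_between cP cdP.
split; last first.
  split=> [k []//|b kb]; apply: ylub => x /between[k [kk xk ky]].
  by apply: le_trans xk (kb _ _).
split=> [|a b [aa ay] [bb bY]].
  by have [k [kk _ ky]] := between _ _ x0y; exists k.
have [||c cy [ac bc]] := diry a b.
- exact: le_way_below_le aa ay.
- exact: le_way_below_le bb bY.
have [k [kk ck ky]] := between _ _ cy.
by exists k => //; rewrite (le_trans ac) ?(le_trans bc).
Qed.

Lemma countable_continuous_domain_algebraic : countable [set: P] ->
  continuous_domain P <-> algebraic_domain P.
Proof.
move=> cP; split=> [cdP|[dP aP]].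
  by split; [exact: cdP.1|exact: countable_continuous_algebraic].
by split; last exact: algebraic_continuous.
Qed.

End CountableContinuous.

(** * Closed sets of a sober space with countably many opens *)

Section SoberCountable.
Variable X : topologicalType.
Implicit Types (x y : X) (A B C M : set X).

Lemma closure1_subset C x : closed C -> C x -> closure [set x] `<=` C.
Proof.
by move=> cC Cx; rewrite [C in _ `<=` C](closure_id C).1 //; apply: closureS => _ ->.
Qed.

Lemma closure_subset_closed A C : closed C -> A `<=` C -> closure A `<=` C.
Proof.
by move=> cC AC; rewrite [C in _ `<=` C](closure_id C).1 //; exact: closureS.
Qed.

Lemma irreducible_generic A : sober X -> irreducible_set A ->
  exists x, closure A = closure [set x].
Proof.
move=> sX [[a Aa] irrA].
have [|x [Ax _]] := sX (closure A) (@closed_closure _ A).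
  split=> [|E F cE cF AEF]; first by exists a; exact: subset_closure.
  have [|AE|AF] := irrA E F cE cF.
  - by apply: subset_trans AEF; exact: subset_closure.
  - by left; exact: closure_subset_closed.
  - by right; exact: closure_subset_closed.
by exists x.
Qed.

Definition maximal_points C : set X :=
  [set x | C x /\ forall y, C y -> closure [set y] x -> y = x].

(** Zorn's lemma applies because a chain is irreducible: the generic point of its
    closure is an upper bound of the chain that stays in C. *)
Lemma exists_maximal_point C x : sober X -> closed C -> C x ->
  exists2 m, maximal_points C m & closure [set m] x.
Proof.
move=> sX cC Cx; have T0 := sober_kolmogorov sX.
pose T := {y | C y /\ closure [set y] x}.
pose R (s t : T) := `[< closure [set sval t] (sval s) >].
have [|r s t /asboolP rs /asboolP st|[s Ps] [t Pt] /asboolP /= st /asboolP /= ts|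
    A totA|[m [Cm mx]] mmax] := @Zorn T R.
- by move=> t; apply/asboolP; exact: closure1_mem.
- by apply/asboolP; exact: closure1_sub st _ rs.
- by apply: eq_exist; exact: closure1_anti T0 st ts.
- have [[a0 Aa0]|A0] := pselect (A !=set0); last first.
    exists (exist _ x (conj Cx (@closure1_mem _ x))) => s As.
    by case: A0; exists s.
  pose B := [set sval a | a in A].
  have [|g Bg] := @irreducible_generic B sX.
    split=> [|E F cE cF BEF]; first by exists (sval a0), a0.
    have [?|/existsNP[_ /not_implyP[[a Aa <-] nEa]]] := pselect (B `<=` E).
      by left.
    right=> _ [b Ab <-].
    have [/asboolP ab|/asboolP ba] := totA _ _ Aa Ab.
      have [Eb|//] : (E `|` F) (sval b) by apply: BEF; exists b.
      by case: nEa; exact: closure1_subset ab.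
    have [//|Fa] : (E `|` F) (sval a) by apply: BEF; exists a.
    exact: closure1_subset ba.
  have gB b : A b -> closure [set g] (sval b).
    by move=> Ab; rewrite -Bg; apply: subset_closure; exists b.
  have Cg : C g.
    have /closure_subset_closed : B `<=` C by move=> _ [[b []] ? ? _ <-].
    by apply => //; rewrite Bg; exact: closure1_mem.
  have gx : closure [set g] x.
    by apply: closure1_sub (gB _ Aa0) _ _; case: a0 {Aa0} => ? [].
  by exists (exist _ g (conj Cg gx)) => s As; apply/asboolP; exact: gB.
exists m => //; split=> // y Cy ym.
have yx : closure [set y] x by exact: closure1_sub ym _ mx.
by have /(congr1 sval) := mmax (exist _ y (conj Cy yx)) (asboolT ym).
Qed.

(** The set M is not irreducible: a generic point of its closure would lie in C
    and above every point of M, hence equal all of them by maximality.  So M is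
    covered by two closed sets that both miss part of it, and one of them
    contains infinitely many points of M. *)
Lemma infinite_maximal_points_split C M : sober X -> closed C ->
  M `<=` maximal_points C -> infinite_set M ->
  exists2 B, closed B & infinite_set (M `&` B) /\ M `\` B !=set0.
Proof.
move=> sX cC MC infM; apply: contrapT => noB.
have proper B : closed B -> ~ M `<=` B -> finite_set (M `&` B).
  move=> cB /existsNP[x /not_implyP[Mx nBx]]; apply: contrapT => inf.
  by apply: noB; exists B => //; split=> //; exists x.
have [|g Mg] := @irreducible_generic M sX.
  split=> [|E F cE cF MEF].
    by apply/set0P/eqP => M0; apply: infM; rewrite M0.
  apply: contrapT => /not_orP[/(proper _ cE) finE /(proper _ cF) finF].
  apply: infM; rewrite (_ : M = (M `&` E) `|` (M `&` F)) ?finite_setU//.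
  by rewrite -setIUr; apply/esym/setIidl.
have Cg : C g.
  have /(closure_subset_closed cC) : M `<=` C by move=> x /MC[].
  by apply; rewrite Mg; exact: closure1_mem.
apply: infM; apply: sub_finite_set (finite_set1 g) => x Mx /=.
have [_ xmax] := MC x Mx.
by apply/esym/xmax => //; rewrite -Mg; exact: subset_closure.
Qed.

(** Cantor's diagonal argument.  From infinitely many maximal points one extracts
    x_n and decreasing closed sets B_n with x_n in B_n but not in B_(n+1); then
    no x_n is in the closure of the others: those of smaller index are
    incomparable to it, those of larger index are in B_(n+1).  Thus the closure
    of { x_n | x_n in e_n }, where e_n enumerates the opens, differs from the
    complement of every e_k at the point x_k. *)
Lemma finite_maximal_points C : sober X -> countable [set: opens X] ->
  closed C -> finite_set (maximal_points C).
Proof.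
move=> sX cX cC; apply: contrapT => infM; set M := maximal_points C in infM.
have [e eP] := countable_enum (Opens (mem_set (@openT X))) cX.
pose inv B := closed B /\ infinite_set (M `&` B).
pose R (n : nat) B B' := B' `<=` B /\ (M `&` B) `\` B' !=set0.
have [|n B [cB infB]|B BP] := @dependent_choice_inv _ inv R.
- by exists setT; split; [exact: closedT|rewrite setIT].
- have [B' cB' [infB' neB']] :=
    infinite_maximal_points_split sX cC (@subIsetl _ M B) infB.
  exists (B `&` B'); first by split; [exact: closedI|rewrite setIA].
  split; first exact: subIsetl.
  by case: neB' => x [[Mx Bx] nB'x]; exists x; split=> // -[].
have decr : {homo B : m n / (m <= n)%N >-> n `<=` m}.
  apply: homo_leq => [A|D E F ED DF|i]; [exact: subset_refl|exact: subset_trans DF ED|].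
  by have [_ []] := BP i.
have /choice[x xP] : forall n, exists x, ((M `&` B n) `\` B n.+1) x.
  by move=> n; have [_ [_]] := BP n.
pose S := [set n | (e n : set X) (x n)].
have [k ek] : exists k, e k = Opens (mem_set (closed_openC (@closed_closure _ (x @` S)))).
  exact: eP.
have ekE : (e k : set X) = ~` closure (x @` S) by rewrite ek.
have [[Mxk Bxk] _] := xP k.
have nSk : ~ S k.
  by move=> Sk; move: (Sk); rewrite /S /= ekE; apply; apply: subset_closure; exists k.
apply: (nSk); rewrite /S /= ekE => clxk.
(* As k is not in S, the finite union and B_(k+1) together cover x @` S. *)
pose E := (\bigcup_(m in `I_k) closure [set x m]) `|` B k.+1.
have cE : closed E.
  apply: closedU; last by have [[]] := BP k.+1.
  by apply: closed_bigcup => [|i _]; [exact: finite_II|exact: closed_closure].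
have [[m mk xmk]|] : E (x k); last by have [_] := xP k.
  apply: closure_subset_closed clxk => // _ [m Sm <-].
  case: (ltngtP m k) => [mk|km|mk]; last 1 first.
  - by case: nSk; rewrite -mk.
  - by left; exists m => //; exact: closure1_mem.
  - by right; apply: decr km _ _; have [[]] := xP m.
have [[[Cm _] _] nBm] := xP m; apply: nBm.
by rewrite (Mxk.2 _ Cm xmk); exact: decr mk _ Bxk.
Qed.

(** Every point of C lies in the closure of one of its maximal points. *)
Lemma closed_finite_union C : sober X -> countable [set: opens X] ->
  closed C -> exists2 F, finite_set F & C = \bigcup_(x in F) closure [set x].
Proof.
move=> sX cX cC; exists (maximal_points C); first exact: finite_maximal_points.
rewrite eqEsubset; split=> [x /(exists_maximal_point sX cC)[m]|x [m [Cm _]]].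
  by exists m.
exact: closure1_subset.
Qed.

End SoberCountable.

(** * The lattice of opens *)

Section OpensLattice.
Variable X : topologicalType.
Implicit Types (U V : opens X) (D : set (opens X)).

Definition opens_of (A : set X) (oA : open A) : opens X := Opens (mem_set oA).

Lemma opens_open U : open (U : set X).
Proof. by case: U => A /= /set_mem. Qed.

Lemma isLub_opens D U :
  isLub D U <-> (U : set X) = \bigcup_(V in D) (V : set X).
Proof.
have oD : open (\bigcup_(V in D) (V : set X)).
  by apply: bigcup_open => V _; exact: opens_open.
split=> [[Uub Ulub]|UD].
  rewrite eqEsubset; split; last first.
    by apply: bigcup_sub => V DV; apply/opens_leP; exact: Uub.
  have /opens_leP : (U <= opens_of oD)%O; last by [].
  by apply: Ulub => V DV; apply/opens_leP; exact: bigcup_sup.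
split=> [V DV|W Wub]; apply/opens_leP; rewrite UD.
  exact: bigcup_sup.
by apply: bigcup_sub => V DV; apply/opens_leP; exact: Wub.
Qed.

Lemma dcpo_opens : dcpo (opens X).
Proof.
move=> D _; have oD : open (\bigcup_(V in D) (V : set X)).
  by apply: bigcup_open => V _; exact: opens_open.
by exists (opens_of oD); apply/isLub_opens.
Qed.

Lemma way_below_opensP V U : way_below V U <->
  forall D, directed_subset D -> (U : set X) `<=` \bigcup_(W in D) (W : set X) ->
    exists2 W, D W & (V : set X) `<=` (W : set X).
Proof.
split=> [VU D dD UD|VU D s dD /isLub_opens sD /opens_leP Us].
  have [s /[dup] Ds /isLub_opens sD] := dcpo_opens dD.
  have [|W DW /opens_leP VW] := VU D s dD Ds; first by apply/opens_leP; rewrite sD.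
  by exists W.
have [|W DW VW] := VU D dD; first by rewrite -sD.
by exists W => //; apply/opens_leP.
Qed.

Lemma directed_way_below_opens U : directed_subset [set V | way_below V U].
Proof.
split=> [|V1 V2 /way_below_opensP VU1 /way_below_opensP VU2].
  exists (opens_of open0); apply/way_below_opensP => D [[W DW] _] _.
  by exists W => //; exact: sub0set.
exists (opens_of (openU (opens_open V1) (opens_open V2))).
  apply/way_below_opensP => D dD UD.
  have [W1 DW1 VW1] := VU1 D dD UD; have [W2 DW2 VW2] := VU2 D dD UD.
  have [W DW [/opens_leP W1W /opens_leP W2W]] := dD.2 _ _ DW1 DW2.
  by exists W => //= x [/VW1/W1W|/VW2/W2W].
by split; apply/opens_leP => x Vx; [left|right].
Qed.

(** Directedness comes for free, as the opens way below U are closed under binary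
    union; only the supremum condition remains. *)
Lemma continuous_opensP : continuous_poset (opens X) <->
  forall U x, (U : set X) x -> exists2 V, way_below V U & (V : set X) x.
Proof.
split=> [cX U x Ux|cX U].
  by have [_ /isLub_opens UE] := cX U; move: Ux; rewrite UE => -[V]; exists V.
split; first exact: directed_way_below_opens.
apply/isLub_opens; rewrite eqEsubset; split=> [x /cX[V]|]; first by exists V.
by apply: bigcup_sub => V /way_below_le/opens_leP.
Qed.

End OpensLattice.

(** * The dual of the specialization order *)

Section DualSpecialization.
Context (X : topologicalType) (sX : sober X) (cX : countable [set: opens X]).
Local Notation Xge := ((spec (sober_kolmogorov sX))^d)%O.
Implicit Types (x y : Xge) (F G : set Xge).

Lemma up_setE F : up_set F = \bigcup_(x in F) closure [set (x : X)].
Proof.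
by rewrite eqEsubset; split=> y [x Fx /dual_spec_leP xy]; exists x.
Qed.

Lemma up_set1E x : up_set [set x] = closure [set (x : X)].
Proof. by rewrite up_setE bigcup_set1. Qed.

Lemma sub_up_set F : F `<=` up_set F.
Proof. by move=> x Fx; exists x. Qed.

Lemma up_set_le F x y : up_set F x -> (x <= y)%O -> up_set F y.
Proof. by move=> [z Fz zx] xy; exists z => //; exact: le_trans xy. Qed.

Lemma closed_up_set F : finite_set F -> closed (up_set F : set X).
Proof.
by move=> finF; rewrite up_setE; apply: closed_bigcup => // x _; exact: closed_closure.
Qed.

Lemma closed_up_setE (C : set X) : closed C ->
  exists2 F : set Xge, finite_set F & C = up_set F.
Proof.
by move=> /(closed_finite_union sX cX)[F finF CF]; exists F; rewrite ?up_setE.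
Qed.

Lemma up_set_isLub (D : set Xge) (s : Xge) : isLub D s ->
  up_set [set s] = \bigcap_(x in D) up_set [set x].
Proof.
move=> [sub slub]; rewrite eqEsubset; split=> [y [_ -> sy] x Dx|y Dy].
  by exists x => //; apply: le_trans sy; exact: sub.
by exists s => //; apply: slub => x /Dy[_ ->].
Qed.

Definition compl_up F (finF : finite_set F) : opens X :=
  opens_of (closed_openC (closed_up_set finF)).

(** For D directed in the dual order with supremum s, the complements of the
    closures of the points of D form a directed family of opens whose union is
    the complement of the closure of s. *)
Lemma way_below_set_of_opens F G (finF : finite_set F) (finG : finite_set G) :
  way_below (compl_up finF) (compl_up finG) -> way_below_set F G.
Proof.
move=> /way_below_opensP FG D s [[x0 Dx0] dirD] Ds Gs.
pose N x := compl_up (finite_set1 x).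
have [||_ [x Dx <-] FNx] := FG [set N x | x in D].
- split=> [|_ _ [x Dx <-] [y Dy <-]]; first by exists (N x0), x0.
  have [z Dz [xz yz]] := dirD x y Dx Dy.
  exists (N z); first by exists z.
  by split; apply/opens_leP; apply: subsetC => t [_ -> zt];
    [exists x|exists y] => //; exact: le_trans zt.
- move=> t /= nGt; apply: contrapT => nDt; apply: nGt.
  suff [_ -> st] : up_set [set s] t by exact: up_set_le st.
  rewrite (up_set_isLub Ds) => x Dx; apply: contrapT => nxt.
  by apply: nDt; exists (N x) => //; exists x.
exists x => //; apply: contrapT => nFx; apply: (FNx x nFx).
exact: sub_up_set.
Qed.

Lemma way_below_set_mem F x : way_below_set F [set x] -> up_set F x.
Proof.
move=> /(_ _ _ (directed_subset1 x) (isLub1 x))[|_ -> //].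
exact: sub_up_set.
Qed.

(** This gives the upper bounds in both families [fin x] and [finc x]. *)
Lemma way_below_set_meet F1 F2 F G1 G2 G :
  up_set F = up_set F1 `&` up_set F2 ->
  up_set G `<=` up_set G1 -> up_set G `<=` up_set G2 ->
  way_below_set F1 G1 -> way_below_set F2 G2 -> way_below_set F G.
Proof.
move=> FE GG1 GG2 FG1 FG2 D s dD Ds Gs.
have [x1 Dx1 F1x1] := FG1 D s dD Ds (GG1 _ Gs).
have [x2 Dx2 F2x2] := FG2 D s dD Ds (GG2 _ Gs).
have [x Dx [x1x x2x]] := dD.2 _ _ Dx1 Dx2.
by exists x => //; rewrite FE; split; [exact: up_set_le x1x|exact: up_set_le x2x].
Qed.

Lemma smyth_meet F1 F2 F : up_set F = up_set F1 `&` up_set F2 ->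
  smyth F1 F /\ smyth F2 F.
Proof. by move=> FE; split=> x /sub_up_set; rewrite FE => -[]. Qed.

Lemma exists_meet F1 F2 : finite_set F1 -> finite_set F2 ->
  exists2 F, finite_set F & up_set F = up_set F1 `&` up_set F2.
Proof.
move=> fin1 fin2.
have [F finF FE] := closed_up_setE (closedI (closed_up_set fin1) (closed_up_set fin2)).
by exists F.
Qed.

(** Generators of the whole space, which is closed. *)
Lemma exists_bottom_set : exists2 F, finite_set F & forall G, way_below_set F G.
Proof.
have [F finF FE] := closed_up_setE (@closedT X).
exists F => // G D s [[x Dx] _] _ _; exists x => //.
by rewrite -FE.
Qed.

Lemma directed_fin x : directed smyth (fin x).
Proof.
split=> [|F1 F2 [fin1 F1x] [fin2 F2x]].
  by have [F finF FG] := exists_bottom_set; exists F.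
have [F finF FE] := exists_meet fin1 fin2; exists F; last exact: smyth_meet.
by split=> //; exact: way_below_set_meet FE _ _ F1x F2x.
Qed.

Lemma directed_finc x : directed smyth (finc x).
Proof.
split=> [|F1 F2 [fin1 FF1 F1x] [fin2 FF2 F2x]].
  by have [F finF FG] := exists_bottom_set; exists F.
have [F finF FE] := exists_meet fin1 fin2; exists F; last exact: smyth_meet.
split=> //; last exact: way_below_set_meet FE _ _ F1x F2x.
by apply: (way_below_set_meet FE _ _ FF1 FF2); rewrite FE => y [].
Qed.

Lemma up_set_bigcap (S : set (set Xge)) x :
  (forall F, S F -> way_below_set F [set x]) ->
  (forall y, ~ (x <= y)%O -> exists2 F, S F & ~ up_set F y) ->
  up_set [set x] = \bigcap_(F in S) up_set F.
Proof.
move=> Sx Sy; rewrite eqEsubset; split=> [y [_ -> xy] F SF|y Fy].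
  by apply: up_set_le xy; exact: way_below_set_mem (Sx F SF).
exists x => //; apply: contrapT => /Sy[F SF]; apply; exact: Fy.
Qed.

Lemma opens_compl_up (V : opens X) :
  exists F, exists finF : finite_set F, V = compl_up finF.
Proof.
have [F finF FE] := closed_up_setE (open_closedC (opens_open V)).
exists F, finF; apply: val_inj => /=.
by rewrite -FE setCK.
Qed.

(** If y is not above x, it lies in the open complement of the closure of x, hence
    in some compact open V below it; finite generators F of the complement of V
    satisfy F << F << x and separate y from x. *)
Lemma algebraic_opens_quasialgebraic :
  algebraic_poset (opens X) -> quasialgebraic_poset Xge.
Proof.
move=> aX.
have sep x y : ~ (x <= y)%O -> exists2 F, finc x F & ~ up_set F y.
  move=> nxy; pose U := compl_up (finite_set1 x).
  have Uy : (U : set X) y by move=> [_ ->].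
  have [_ /isLub_opens UE] := aX U.
  move: Uy; rewrite UE => -[V [VV VU] Vy].
  have [F [finF VE]] := opens_compl_up V; subst V.
  exists F; last exact: Vy.
  split=> //; first exact: way_below_set_of_opens VV.
  by apply: way_below_set_of_opens; exact: le_way_below_le (lexx _) VV VU.
split=> x; split.
- exact: directed_fin.
- apply: up_set_bigcap => [F []//|y /sep[F [finF _ Fx] nFy]].
  by exists F.
- exact: directed_finc.
- by apply: up_set_bigcap => [F []//|y /sep].
Qed.

(** Suppose that no member of the directed family D contains the complement of
    [up_set F].  Call a closed set C good if it meets, outside [up_set F], the
    complement of every member of D.  The whole space is good, and a good C has
    a point x outside any prescribed W in D whose closure is good: otherwise,
    the finitely many generators of the part of C outside W are each ruled out
    by some member of D, and a common upper bound of these and W contradicts the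
    goodness of C.  Running through an enumeration of the opens gives an
    increasing sequence in the dual order, each of whose points is outside
    [up_set F], while its supremum avoids all members of D, and so belongs to
    [up_set G]. *)
Lemma way_below_set_opens F G (finF : finite_set F) (finG : finite_set G) :
  dcpo Xge -> way_below_set F G ->
  way_below (compl_up finF) (compl_up finG).
Proof.
move=> dX FG; apply/way_below_opensP => D dD GD; apply: contrapT => noW.
have [[W0 DW0] dirD] := dD.
have [e eP] := countable_enum W0 cX.
pose good (C : set X) := forall W, D W -> C `&` ~` W `&` ~` up_set F !=set0.
have good_refine C W : closed C -> good C -> D W ->
    exists2 x, good (closure [set x]) & (C `&` ~` W) x.
  move=> cC gC DW.
  have [H finH HE] := closed_up_setE (closedI cC (open_closedC (opens_open W))).
  apply: contrapT => nogood.
  pose Q x (W' : opens X) :=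
    closure [set (x : X)] `&` ~` W' `&` ~` up_set F = set0.
  have [||W' DW' QW'] := @directed_finite _ _ _ D H Q _ dD finH.
  - move=> x V V' /opens_leP VV' QV; apply/seteqP; split=> // y [[xy nV'y] nFy].
    by rewrite -QV; split=> //; split=> // /VV'.
  - move=> x Hx; apply: contrapT => nQ; apply: nogood; exists x.
      move=> V DV; apply/set0P/eqP => E0; apply: nQ.
      by exists V.
    by rewrite HE; exact: sub_up_set.
  have [V DV [/opens_leP WV /opens_leP W'V]] := dirD W W' DW DW'.
  have [y [[Cy nVy] nFy]] := gC V DV.
  have : up_set H y by rewrite -HE; split=> // /WV.
  rewrite up_setE => -[x Hx xy].
  suff : (set0 : set X) y by [].
  by rewrite -(QW' x Hx); split=> //; split=> // /W'V.
pose R n (x y : Xge) := (x <= y)%O /\ (D (e n) -> ~ (e n : set X) y).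
have [||u uP] := @dependent_choice_inv _ (fun x : Xge => good (closure [set (x : X)])) R.
- have [|x gx _] := @good_refine setT W0 closedT _ DW0; last by exists x.
  move=> W DW; apply/set0P/eqP => E0; apply: noW; exists W => // y nFy.
  by apply: contrapT => nWy; suff : (set0 : set X) y by []; rewrite -E0.
- move=> n x gx; have [Den|nDen] := pselect (D (e n)); last first.
    by exists x => //; split.
  have [y gy [xy ny]] := good_refine _ _ (@closed_closure _ _) gx Den.
  by exists y => //; split=> // ; apply/dual_spec_leP.
have umono : {homo u : m n / (m <= n)%N >-> (m <= n)%O}.
  apply: homo_leq => [x|? ? ?|i]; [exact: lexx|exact: le_trans|].
  by have [_ []] := uP i.
have dU : directed_subset (range u).
  split=> [|_ _ [m _ <-] [n _ <-]]; first by exists (u 0%N), 0%N.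
  by exists (u (maxn m n)); [exists (maxn m n)|rewrite !umono ?leq_maxl ?leq_maxr].
have [s us] := dX _ dU.
have Gs : up_set G s.
  apply: contrapT => nGs; have [W DW Ws] := GD s nGs.
  have [n en] := eP W; have [_ [_ nWu]] := uP n.
  have us' : (u n.+1 <= s)%O by apply: us.1; exists n.+1.
  move: nWu; rewrite en => /(_ DW); apply; apply: contrapT => nWu.
  move/dual_spec_leP: us' => us'.
  exact: (closure1_subset (open_closedC (opens_open W)) nWu us').
have [_ [n _ <-] Fun] := FG _ _ dU us Gs.
have [gu _] := uP n.
have [y [[/dual_spec_leP uy _] nFy]] := gu _ DW0.
by apply: nFy; exact: up_set_le uy.
Qed.

(** Let U be the complement of [up_set G] and x a point of U.  Each g in G has a
    finite set way below it whose upper closure misses x; the union of these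
    finite sets is way below G, and the complement of its upper closure is the
    required neighbourhood of x. *)
Lemma quasicontinuous_continuous_opens :
  dcpo Xge -> quasicontinuous_poset Xge -> continuous_poset (opens X).
Proof.
move=> dX qX; apply/continuous_opensP => U x.
have [G [finG ->]] := opens_compl_up U => nGx.
have /choice[f fP] : forall g : Xge, exists F, G g -> fin g F /\ ~ up_set F x.
  move=> g; have [Gg|] := pselect (G g); last by exists set0.
  apply: contrapT => noF; apply: nGx; exists g => //.
  suff [_ ->] : up_set [set g] x by [].
  rewrite (qX g).2 => F Fg; apply: contrapT => nFx.
  by apply: noF; exists F.
have finF : finite_set (\bigcup_(g in G) f g).
  by apply: bigcup_finite => // g /fP[[]].
exists (compl_up finF).
  apply: way_below_set_opens => // D s dD Ds [g Gg gs].
  have [[_ fg] _] := fP g Gg.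
  have [|e De [z fz ze]] := fg D s dD Ds; first by exists g.
  by exists e => //; exists z => //; exists g.
move=> [z [g Gg fz] zx]; have [_] := fP g Gg; apply.
by exists z.
Qed.

End DualSpecialization.

Theorem theorem3p5 (X : topologicalType) (sX : sober X)
    (cX : countable [set: opens X]) :
  let Xge := ((spec (sober_kolmogorov sX))^d)%O in
  let S1 := continuous_domain (opens X) in
  let S2 := algebraic_domain (opens X) in
  let S3 := quasicontinuous_poset Xge in
  let S4 := quasialgebraic_poset Xge in
  [/\ S1 <-> S2,
      S1 \/ S2 -> S3 /\ S4 &
      dcpo Xge -> [/\ S1 <-> S2, S2 <-> S3 & S3 <-> S4]].
Proof.
move=> Xge S1 S2 S3 S4.
have S12 : S1 <-> S2 by exact: countable_continuous_domain_algebraic.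
have S24 : S2 -> S4 by move=> [_]; exact: algebraic_opens_quasialgebraic.
have S43 : S4 -> S3 by case.
split=> // [S1S2|dX].
  have s4 : S4 by case: S1S2 => [/S12|] /S24.
  by split; first exact: S43.
have S32 : S3 -> S2.
  move=> s3; apply/S12; split; first exact: dcpo_opens.
  exact: quasicontinuous_continuous_opens.
by split=> //; split=> //; [move=> /S24/S43|move=> /S32/S24].
Qed.
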